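(* Let $R_7$ be the tournament on $\{0,1,\ldots,6\}$ with arcs $0\to1$, $0\to3$, $0\to6$, $1\to2$, $1\to5$, $2\to0$, $2\to4$, $2\to6$, $3\to1$, $3\to2$, $3\to4$, $3\to6$, $4\to0$, $4\to1$, $4\to5$, $5\to0$, $5\to2$, $5\to3$, $6\to1$, $6\to4$, $6\to5$. There is a graph homomorphism $\vec\Gamma_{1,3,4}\to R_7$. Consequently, $\chi_{co}(\vec F(2^{\mathbb Z^2}))\le 7$.
   Context: A digraph is an irreflexive binary relation (arc set) on a vertex set; an oriented graph is a digraph whose arc relation is asymmetric; a tournament is an oriented graph in which any two distinct vertices are joined by an arc. A graph homomorphism is a map of vertices sending every arc to an arc. The digraph $\vec\Gamma_{n,p,q}$ (for integers $1\le n<p,q$ with $\gcd(p,q)=1$). A rectangular array of size $w\times h$ has $w$ columns and $h$ rows of vertices; its oriented grid graph has an arc from each vertex to the vertex immediately to its right and an arc from each vertex to the vertex immediately below it (when these exist). There are five labelled blocks, which are rectangular oriented grid graphs of sizes: $R_\times$: $n\times n$; $R_a$: $n\times(p-n)$; $R_b$: $n\times(q-n)$; $R_c$: $(p-n)\times n$; $R_d$: $(q-n)\times n$. For a ''top word'' $t_1\cdots t_k$ and a ''bottom word'' in the letters $c,d$, and a ''left word'' and ''right word'' in the letters $a,b$, the corresponding tile is the rectangular oriented grid graph in which: the top $n$ rows, read from left to right, are divided into blocks labelled $R_\times,R_{t_1},R_\times,R_{t_2},\ldots,R_{t_k},R_\times$; the bottom $n$ rows, read from left to right, are divided in the same way using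 the bottom word; the leftmost (resp. rightmost) $n$ columns, read from top to bottom, are divided in the same way using the left (resp. right) word; the four $n\times n$ corners are thus blocks $R_\times$; the remaining vertices are unlabelled. The twelve tiles are given by (top; bottom; left; right): $(c;c;a;a)$, $(c;c;b;b)$, $(d;d;a;a)$, $(d;d;b;b)$, $(dc;cd;a;a)$, $(cd;dc;a;a)$, $(c;c;ab;ba)$, $(c;c;ba;ab)$, $(c^q;d^p;a;a)$, $(d^p;c^q;a;a)$, $(c;c;a^q;b^p)$, $(c;c;b^p;a^q)$. The digraph $\vec\Gamma_{n,p,q}$ is the quotient of the disjoint union of the twelve tiles obtained by identifying all equally labelled blocks (in the same or in different tiles), vertices in the same relative position being identified; there is an arc between two classes iff there is an arc between some representatives in some tile. $2^{\mathbb Z^2}$ carries the product topology and the shift action $(g\cdot x)(h)=x(h+g)$; its free part is $F(2^{\mathbb Z^2})=\{x: g\cdot x\neq x\text{ for every }g\neq(0,0)\}$. The directed Schreier graph $\vec F(2^{\mathbb Z^2})$ has vertex set $F(2^{\mathbb Z^2})$ and arcs $x\to e_1\cdot x$, $x\to e_2\cdot x$, where $e_1=(1,0)$, $e_2=(0,1)$. Its continuous oriented chromatic number $\chi_{co}$ is the least $|V(H)|$ over finite oriented graphs $H$ (with $V(H)$ discrete) admitting a continuous graph homomorphism $\vec F(2^{\mathbb Z^2})\to H$. *)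

(* Defs.v *)
From HB Require Import structures.
From mathcomp Require Import all_boot all_order all_algebra.
From mathcomp Require Import generic_quotient.
From mathcomp Require Import all_classical all_reals all_analysis.

Set Implicit Arguments.
Unset Strict Implicit.
Unset Printing Implicit Defensive.

Import GRing.Theory.

Local Open Scope classical_set_scope.

Definition digraph_hom (V W : Type) (e : V -> V -> Prop) (e' : W -> W -> Prop)
    (f : V -> W) : Prop :=
  forall x y, e x y -> e' (f x) (f y).

Definition oriented (V : finType) (e : rel V) : Prop :=
  irreflexive e /\ forall x y, e x y -> ~~ e y x.

Definition tournament (V : finType) (e : rel V) : Prop :=
  oriented e /\ forall x y, x != y -> e x y || e y x.

Definition R7_arcs : seq (nat * nat) :=
  [:: (0, 1); (0, 3); (0, 6); (1, 2); (1, 5); (2, 0); (2, 4); (2, 6);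
      (3, 1); (3, 2); (3, 4); (3, 6); (4, 0); (4, 1); (4, 5);
      (5, 0); (5, 2); (5, 3); (6, 1); (6, 4); (6, 5)].

Definition R7 : rel 'I_7 :=
  fun i j => (nat_of_ord i, nat_of_ord j) \in R7_arcs.

Lemma R7_tournament : tournament R7.
Proof.
have H (i j : 'I_7) : [&& R7 i i == false, R7 i j ==> ~~ R7 j i
    & (i != j) ==> (R7 i j || R7 j i)].
  case: i => [[|[|[|[|[|[|[|?]]]]]]] ?] //;
  by case: j => [[|[|[|[|[|[|[|?]]]]]]] ?].
split; first split.
- by move=> i; case/and3P: (H i i) => /eqP.
- by move=> i j; case/and3P: (H i j) => _ /implyP.
- by move=> i j; case/and3P: (H i j) => _ _ /implyP.
Qed.

Variant block := Rx | Ra | Rb | Rc | Rd.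

Definition block_eq_dec (x y : block) : {x = y} + {x <> y}.
Proof. by decide equality. Defined.

HB.instance Definition _ := hasDecEq.Build block (compareP block_eq_dec).

Record tile := Tile {
  top_word : seq block; bottom_word : seq block;
  left_word : seq block; right_word : seq block }.

Definition tiles (p q : nat) : 12.-tuple tile :=
  [tuple Tile [:: Rc] [:: Rc] [:: Ra] [:: Ra];
         Tile [:: Rc] [:: Rc] [:: Rb] [:: Rb];
         Tile [:: Rd] [:: Rd] [:: Ra] [:: Ra];
         Tile [:: Rd] [:: Rd] [:: Rb] [:: Rb];
         Tile [:: Rd; Rc] [:: Rc; Rd] [:: Ra] [:: Ra];
         Tile [:: Rc; Rd] [:: Rd; Rc] [:: Ra] [:: Ra];
         Tile [:: Rc] [:: Rc] [:: Ra; Rb] [:: Rb; Ra];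
         Tile [:: Rc] [:: Rc] [:: Rb; Ra] [:: Ra; Rb];
         Tile (nseq q Rc) (nseq p Rd) [:: Ra] [:: Ra];
         Tile (nseq p Rd) (nseq q Rc) [:: Ra] [:: Ra];
         Tile [:: Rc] [:: Rc] (nseq q Ra) (nseq p Rb);
         Tile [:: Rc] [:: Rc] (nseq p Rb) (nseq q Ra)].

(* The word t1 ... tk stands for the division Rx, t1, Rx, t2, ..., tk, Rx. *)
Definition division (w : seq block) : seq block :=
  Rx :: flatten [seq [:: b; Rx] | b <- w].

(* The block containing position [i] of the division of [w], and the position
   relative to that block, when the block [b] has length [len b]. *)
Definition locate (len : block -> nat) (w : seq block) (i : nat) :
    block * nat :=
  let sh := [seq len b | b <- division w] in
  (nth Rx (division w) (reshape_index sh i), reshape_offset sh i).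

(* Meant for 1 <= n < p, q with p and q coprime; in particular the truncated
   subtractions p - n and q - n below are then genuine. *)
Section Gamma.
Variables n p q : nat.

Definition block_width (b : block) : nat :=
  match b with Rx => n | Ra => n | Rb => n | Rc => p - n | Rd => q - n end.

Definition block_height (b : block) : nat :=
  match b with Rx => n | Ra => p - n | Rb => q - n | Rc => n | Rd => n end.

(* When n < p, q the bottom (resp. right) word yields the same total length as
   the top (resp. left) one, in each of the twelve tiles. *)
Definition tile_width (t : tile) : nat :=
  sumn [seq block_width b | b <- division (top_word t)].

Definition tile_height (t : tile) : nat :=
  sumn [seq block_height b | b <- division (left_word t)].

(* Disjoint union of the tiles: the tile index, then the column counted from the
   left and the row counted from the top. *)
Definition tile_vertex : Type :=
  {t : 'I_12 & ('I_(tile_width (tnth (tiles p q) t))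
                * 'I_(tile_height (tnth (tiles p q) t)))%type}.

Definition tile_of (u : tile_vertex) : tile := tnth (tiles p q) (tag u).
Definition tile_col (u : tile_vertex) : nat := (tagged u).1.
Definition tile_row (u : tile_vertex) : nat := (tagged u).2.

Definition tile_arc : rel tile_vertex := fun u v =>
  (tag u == tag v) &&
  (((tile_col v == (tile_col u).+1) && (tile_row v == tile_row u))
   || ((tile_col v == tile_col u) && (tile_row v == (tile_row u).+1))).

(* The block containing [u], with the relative column and row of [u] in it;
   [None] if [u] is unlabelled. The four tests overlap only in the corners, and
   there both readings give the block Rx with the same relative position. *)
Definition position (u : tile_vertex) : option (block * nat * nat) :=
  let t := tile_of u in
  let x := tile_col u in
  let y := tile_row u in
  let w := tile_width t in
  let h := tile_height t in
  if y < n then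
    let: (b, i) := locate block_width (top_word t) x in Some (b, i, y)
  else if h - n <= y then
    let: (b, i) := locate block_width (bottom_word t) x in
    Some (b, i, y - (h - n))
  else if x < n then
    let: (b, j) := locate block_height (left_word t) y in Some (b, x, j)
  else if w - n <= x then
    let: (b, j) := locate block_height (right_word t) y in
    Some (b, x - (w - n), j)
  else None.

Definition identified : rel tile_vertex := fun u v =>
  (u == v) || ((position u != None) && (position u == position v)).

Lemma identified_refl : reflexive identified.
Proof. by move=> u; rewrite /identified eqxx. Qed.

Lemma identified_sym : symmetric identified.
Proof.
move=> u v; rewrite /identified [u == v]eq_sym [position u == position v]eq_sym.
by case: (position v =P position u) => [->|_]; rewrite ?andbF.
Qed.

Lemma identified_trans : transitive identified.
Proof.
move=> v u w; rewrite /identified.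
case: eqVneq => [->//|_] /= /andP[uN /eqP uv].
case: eqVneq => [<-|_] /=; first by rewrite uN uv eqxx orbT.
by move=> /andP[_ /eqP vw]; rewrite uN uv vw eqxx orbT.
Qed.

Canonical identified_equiv :=
  EquivRel identified identified_refl identified_sym identified_trans.

Definition Gamma : Type := {eq_quot identified_equiv}%qT.

Definition Gamma_arc (x y : Gamma) : Prop :=
  exists u v : tile_vertex,
    [/\ (\pi_({eq_quot identified_equiv}%qT) u)%qT = x,
        (\pi_({eq_quot identified_equiv}%qT) v)%qT = y & tile_arc u v].

End Gamma.

Section ContinuousOrientedChromaticNumber.
Variables (X : topologicalType) (e : X -> X -> Prop).

Definition co_colorable (k : nat) : Prop :=
  exists (V : finType) (a : rel V), [/\ oriented a, #|V| = k &
    exists f : X -> discrete_topology V, continuous f /\ digraph_hom e a f].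

(* [is_chi_co k]: the continuous oriented chromatic number exists and equals k. *)
Definition is_chi_co (k : nat) : Prop :=
  co_colorable k /\ forall m, co_colorable m -> k <= m.

End ContinuousOrientedChromaticNumber.

Definition Z2 : Type := (int * int)%type.
HB.instance Definition _ := GRing.Zmodule.on Z2.

Definition shift_space : Type := prod_topology (fun _ : Z2 => bool).
HB.instance Definition _ := Topological.on shift_space.

Definition shift_act (g : Z2) (x : shift_space) : shift_space :=
  fun h => x (h + g)%R.

Definition free_part : set shift_space :=
  [set x | forall g : Z2, g <> 0%R -> shift_act g x <> x].

Definition e1 : Z2 := (1%R, 0%R).
Definition e2 : Z2 := (0%R, 1%R).

(* [set_type free_part] carries the subspace topology. *)
Definition schreier_arc (x y : set_type free_part) : Prop :=
  set_val y = shift_act e1 (set_val x) \/ set_val y = shift_act e2 (set_val x).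

(* Main.v *)
Require Import Defs.
From HB Require Import structures.
From mathcomp Require Import all_boot all_order all_algebra.
From mathcomp Require Import generic_quotient.
From mathcomp Require Import all_classical all_reals all_analysis.
From mathcomp Require Import zify.

Set Implicit Arguments.
Unset Strict Implicit.
Unset Printing Implicit Defensive.

Import Order.TTheory GRing.Theory Num.Theory.

(** The homomorphism on the twelve tiles is a finite object. Send every R_x to
    the vertex 0 of R7, every R_a and R_c to the interior of the directed
    3-cycle 0 1 2, and every R_b and R_d to the interior of the directed 4-cycle
    0 3 4 5. This colours the whole rim of every tile consistently, and the
    unlabelled interior of each tile can be filled in independently of the other
    tiles ([tile_colour_arcs]).

    For the bound on the continuous oriented chromatic number, note that for
    each p modulo 3 the map (x, y) |-> x + y + p mod 3 is a homomorphism of the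
    grid to the 3-cycle 0 1 2 of R7. Call p its phase. R7 is flexible in two
    ways. First, a strip of width 5 suffices to pass from any phase on one side
    of a vertical or horizontal line to any phase on the other side. Secondly,
    where a vertical and a horizontal strip cross, the 5 x 5 square they share
    can be filled for each of the 81 choices of phases in the four quadrants.
    Hence ([rule_arcs]) a phase field on the grid yields a homomorphism to R7,
    by a rule that reads only a 6 x 6 window, as soon as in every 7 x 7 window
    the phase is constant on the four quadrants cut out by at most one vertical
    and one horizontal line.

    It remains to build such a phase field continuously on the free part of the
    shift ([phase_quadrants]). Freeness provides, for every D, a locally constant
    colouring by natural numbers that separates any two points of an orbit at
    distance at most D ([separating_colouring]). Going through the points in the
    order of these colours, one chooses greedily and continuously
    ([greedy_exists]) a set of markers that is N-separated and N-dense, each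
    marker with a square around it of radius between N and 2N. Only boundedly
    many earlier markers are close to a new one, and each forbids boundedly many
    radii, so for N large the lines carrying the sides of different nearby
    squares can be kept at distance at least 6 from each other
    ([good_radius_exists], [markers_exist]). The squares cover every orbit, and
    a point takes its phase from its coordinates relative to the centre of the
    covering square with the least colour. In a 7 x 7 window the answer depends
    only on the position relative to the sides of nearby squares, and at most
    one vertical and one horizontal side line enter the window. *)

(** * Colours as natural numbers *)

Definition R7_arc (u v : nat) : bool := (u, v) \in R7_arcs.

Definition arcs_ok (W H : nat) (f : nat -> nat -> nat) : bool :=
  all (fun x => all (fun y =>
    ((x.+1 < W) ==> R7_arc (f x y) (f x.+1 y)) &&
    ((y.+1 < H) ==> R7_arc (f x y) (f x y.+1))) (iota 0 H)) (iota 0 W).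

Lemma arcs_okP W H f x y : arcs_ok W H f -> x < W -> y < H ->
  (x.+1 < W -> R7_arc (f x y) (f x.+1 y)) /\ (y.+1 < H -> R7_arc (f x y) (f x y.+1)).
Proof.
move=> /allP fok xW yH.
have x_in : x \in iota 0 W by rewrite mem_iota.
have /allP/(_ y) := fok x x_in; rewrite mem_iota => /(_ yH).
by case/andP=> /implyP ? /implyP ?.
Qed.

Lemma R7_inord u v : R7_arc u v -> R7 (inord u) (inord v).
Proof.
move=> uv; have : (u < 7) && (v < 7).
  have /allP/(_ _ uv) // : all (fun e => (e.1 < 7) && (e.2 < 7)) R7_arcs by [].
by case/andP=> u7 v7; rewrite /R7 !inordK.
Qed.

(** * The homomorphism on the twelve tiles *)

(** Between two vertices 0 these sequences close a directed 3-cycle, resp.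
    4-cycle, of R7; they serve for rows and columns alike. *)
Definition block_colours (b : block) : seq nat :=
  match b with
  | Rx => [:: 0]
  | Ra | Rc => [:: 1; 2]
  | Rb | Rd => [:: 3; 4; 5]
  end.

(** The interiors, row by row, in the order of [tiles 3 4]; they were found by a
    backtracking search with the rims prescribed. *)
Definition tile_interiors : seq (seq (seq nat)) := [::
  [:: [:: 2;0]; [:: 0;1]];
  [:: [:: 2;0]; [:: 0;3]; [:: 3;1]];
  [:: [:: 2;0;3]; [:: 0;3;1]];
  [:: [:: 1;5;0]; [:: 5;0;3]; [:: 0;3;1]];
  [:: [:: 2;0;3;1;5;0]; [:: 0;3;4;5;3;1]];
  [:: [:: 2;0;3;4;0;3]; [:: 0;3;1;5;3;1]];
  [:: [:: 2;0]; [:: 0;3]; [:: 3;1]; [:: 4;5]; [:: 0;3]; [:: 3;1]];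
  [:: [:: 2;0]; [:: 0;3]; [:: 3;4]; [:: 1;5]; [:: 5;3]; [:: 0;1]];
  [:: [:: 2;0;3;2;4;1;2;6;1;5;0]; [:: 0;3;6;4;5;2;6;4;5;3;1]];
  [:: [:: 2;0;3;6;1;5;0;3;1;5;0]; [:: 0;1;2;4;5;2;6;1;2;0;1]];
  [:: [:: 2;0]; [:: 0;3]; [:: 3;6]; [:: 2;4]; [:: 4;5]; [:: 1;2]; [:: 2;6]; [:: 6;4]; [:: 1;5]; [:: 5;3]; [:: 0;1]];
  [:: [:: 2;0]; [:: 0;1]; [:: 3;2]; [:: 6;4]; [:: 1;5]; [:: 5;2]; [:: 0;6]; [:: 3;1]; [:: 4;5]; [:: 0;3]; [:: 3;1]]].

(** [position] in terms of natural numbers only, so that it can be evaluated at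
    all the vertices of all the tiles. *)
Definition tile_label (n p q : nat) (t : tile) (x y : nat) :
    option (block * nat * nat) :=
  let w := tile_width n p q t in
  let h := tile_height n p q t in
  if y < n then
    let: (b, i) := locate (block_width n p q) (top_word t) x in Some (b, i, y)
  else if h - n <= y then
    let: (b, i) := locate (block_width n p q) (bottom_word t) x in
    Some (b, i, y - (h - n))
  else if x < n then
    let: (b, j) := locate (block_height n p q) (left_word t) y in Some (b, x, j)
  else if w - n <= x then
    let: (b, j) := locate (block_height n p q) (right_word t) y in
    Some (b, x - (w - n), j)
  else None.

Lemma positionE n p q (u : tile_vertex n p q) :
  position u = tile_label n p q (tile_of u) (tile_col u) (tile_row u).
Proof. by []. Qed.

Definition tile_colour (k x y : nat) : nat :=
  let t := nth (Tile [::] [::] [::] [::]) (tiles 3 4) k in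
  if tile_label 1 3 4 t x y is Some (b, i, j) then nth 0 (block_colours b) (i + j)
  else nth 0 (nth [::] (nth [::] tile_interiors k) y.-1) x.-1.

Lemma tile_colour_arcs : all (fun k =>
  let t := nth (Tile [::] [::] [::] [::]) (tiles 3 4) k in
  arcs_ok (tile_width 1 3 4 t) (tile_height 1 3 4 t) (tile_colour k)) (iota 0 12).
Proof. by vm_compute. Qed.

Definition vertex_colour (u : tile_vertex 1 3 4) : nat :=
  tile_colour (tag u) (tile_col u) (tile_row u).

(** The interior table is consulted at unlabelled vertices only, and these are
    identified with no other vertex: this makes the colour descend to the
    quotient. *)
Lemma vertex_colour_position (u : tile_vertex 1 3 4) :
  vertex_colour u = if position u is Some (b, i, j)
    then nth 0 (block_colours b) (i + j)
    else nth 0 (nth [::] (nth [::] tile_interiors (tag u)) (tile_row u).-1)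
           (tile_col u).-1.
Proof. by rewrite positionE /vertex_colour /tile_colour -tnth_nth. Qed.

Lemma vertex_colour_identified (u v : tile_vertex 1 3 4) :
  identified u v -> vertex_colour u = vertex_colour v.
Proof.
case/orP=> [/eqP-> //|/andP[pu /eqP puv]].
by rewrite !vertex_colour_position -puv; case: (position u) pu => [[[]]|].
Qed.

Lemma vertex_colour_arc (u v : tile_vertex 1 3 4) :
  tile_arc u v -> R7_arc (vertex_colour u) (vertex_colour v).
Proof.
case: u v => [t [x y]] [t' [x' y']] /andP[/eqP /= tt'].
case: t' / tt' x' y' => x' y'; rewrite /vertex_colour /tile_col /tile_row /=.
have := allP tile_colour_arcs t; rewrite mem_iota ltn_ord => /(_ isT) /=.
rewrite -tnth_nth => /arcs_okP /(_ (ltn_ord x) (ltn_ord y)) [right down].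
have [xw yh] := (ltn_ord x', ltn_ord y').
by case/orP=> /andP[/eqP xx' /eqP yy']; rewrite xx' yy';
  [apply: right; rewrite -xx' | apply: down; rewrite -yy'].
Qed.

Lemma Gamma_hom_R7 :
  exists f : Gamma 1 3 4 -> 'I_7, digraph_hom (@Gamma_arc 1 3 4) R7 f.
Proof.
exists (fun x => inord (vertex_colour (repr x))) => _ _ [u [v [<- <- uv]]].
have col_repr w : vertex_colour (repr (\pi_({eq_quot identified_equiv 1 3 4}%qT) w)%qT)
    = vertex_colour w.
  apply: vertex_colour_identified.
  by have /eqmodP := reprK (\pi_({eq_quot identified_equiv 1 3 4}%qT) w)%qT.
by rewrite !col_repr; apply/R7_inord/vertex_colour_arc.
Qed.

(** * Phases, strips and crossings *)

Definition diag (t : nat) : nat := nth 0 [:: 0; 1; 2] (t %% 3).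

(** The five columns of a vertical strip across which the phase increases by 1
    (first table) or by 2 (second table). A column has period 3, as the colours
    on both sides have. Since the grid has a symmetry that exchanges its two
    kinds of arcs, the transposed strips are used across horizontal lines. *)
Definition strips : seq (seq (seq nat)) := [::
  [:: [:: 6; 5; 0]; [:: 4; 0; 3]; [:: 5; 3; 4]; [:: 3; 4; 5]; [:: 6; 5; 2]];
  [:: [:: 1; 5; 0]; [:: 5; 3; 1]; [:: 3; 4; 5]; [:: 6; 5; 3]; [:: 5; 2; 6]]].

(** Column i at height t of a strip across which the phase increases by k. The
    columns 1 to 5 are the strip proper, column 0 already has the pattern on the
    left and column 6 the one on the right. *)
Definition strip (k i t : nat) : nat :=
  if k %% 3 is k'.+1 then
    if i == 0 then diag t
    else if 5 < i then diag (i + t + k)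
    else nth 0 (nth [::] (nth [::] strips k') i.-1) (t %% 3)
  else diag (i + t).

(** The rim of the 7 x 7 square around a crossing, where a, b, c, d are the phases
    in the NW, NE, SW, SE quadrants, relative to the NW corner. Modulo 3,
    doubling is the same as changing the sign, so that the strips run with the
    increments b - a, d - c, c - a and d - b. *)
Definition crossing_rim (a b c d x y : nat) : nat :=
  if y == 0 then strip (b + a.*2) x a
  else if y == 6 then strip (d + c.*2) x (6 + c)
  else if x == 0 then strip (c + a.*2) y a
  else strip (d + b.*2) y (6 + b).

(** The 5 x 5 interiors, row by row, for the quadruples of phases in lexicographic
    order; they too come from a backtracking search. *)
Definition crossings : seq (seq (seq nat)) := [::
  [:: [:: 2;0;3;2;4]; [:: 0;3;2;6;1]; [:: 3;2;6;4;5]; [:: 2;4;5;0;3]; [:: 4;5;2;6;1]];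
  [:: [:: 2;0;3;2;0]; [:: 0;3;4;0;6]; [:: 3;2;0;6;4]; [:: 2;0;6;4;5]; [:: 0;6;4;5;0]];
  [:: [:: 5;0;1;2;0]; [:: 0;1;5;0;1]; [:: 6;5;3;1;5]; [:: 5;3;6;5;0]; [:: 0;6;5;0;6]];
  [:: [:: 5;0;1;2;4]; [:: 0;3;2;6;1]; [:: 3;6;4;1;2]; [:: 6;1;5;2;4]; [:: 1;5;3;6;1]];
  [:: [:: 5;0;6;5;0]; [:: 0;6;1;2;6]; [:: 3;1;2;6;1]; [:: 6;5;0;1;5]; [:: 5;2;6;5;2]];
  [:: [:: 5;0;1;5;0]; [:: 0;3;2;0;1]; [:: 3;6;4;1;5]; [:: 6;1;5;2;0]; [:: 1;5;0;6;1]];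
  [:: [:: 2;0;6;5;0]; [:: 0;6;4;0;3]; [:: 6;1;5;3;2]; [:: 5;2;0;6;4]; [:: 2;0;3;1;5]];
  [:: [:: 5;0;3;2;0]; [:: 0;3;4;0;6]; [:: 1;2;0;6;1]; [:: 5;0;3;4;5]; [:: 2;6;1;5;3]];
  [:: [:: 5;0;3;2;0]; [:: 3;1;2;0;1]; [:: 6;5;0;6;5]; [:: 5;0;3;1;2]; [:: 2;6;1;2;6]];
  [:: [:: 5;0;3;2;4]; [:: 0;1;2;4;0]; [:: 1;2;6;5;3]; [:: 2;6;1;2;6]; [:: 0;1;5;0;1]];
  [:: [:: 5;0;3;4;1]; [:: 0;3;4;5;2]; [:: 1;2;0;3;4]; [:: 5;0;6;4;1]; [:: 0;3;1;5;2]];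
  [:: [:: 5;0;3;2;4]; [:: 0;1;2;4;5]; [:: 1;2;6;5;0]; [:: 2;0;1;2;6]; [:: 0;1;5;0;1]];
  [:: [:: 1;5;2;4;1]; [:: 5;3;4;1;5]; [:: 2;4;1;5;3]; [:: 4;1;5;2;4]; [:: 1;5;2;6;5]];
  [:: [:: 4;1;2;6;1]; [:: 5;2;6;4;5]; [:: 2;6;4;5;0]; [:: 4;1;5;0;3]; [:: 5;2;0;3;4]];
  [:: [:: 1;5;2;4;1]; [:: 5;3;4;5;2]; [:: 0;1;5;2;0]; [:: 6;5;2;0;3]; [:: 1;2;0;6;4]];
  [:: [:: 5;0;3;6;4]; [:: 0;6;4;5;0]; [:: 6;1;5;0;6]; [:: 1;2;0;3;1]; [:: 2;0;3;6;5]];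
  [:: [:: 5;0;3;4;1]; [:: 3;6;4;5;2]; [:: 6;1;5;0;6]; [:: 5;2;0;6;1]; [:: 2;6;1;5;2]];
  [:: [:: 5;0;3;2;4]; [:: 0;1;2;6;5]; [:: 1;2;6;4;0]; [:: 5;0;1;5;3]; [:: 2;6;5;2;4]];
  [:: [:: 5;0;6;1;2]; [:: 0;3;4;5;0]; [:: 1;2;0;3;6]; [:: 2;0;3;6;1]; [:: 6;1;2;4;5]];
  [:: [:: 2;0;6;1;2]; [:: 6;1;5;2;0]; [:: 1;5;0;6;1]; [:: 2;0;3;4;5]; [:: 0;6;4;5;3]];
  [:: [:: 5;3;1;5;2]; [:: 0;1;2;0;6]; [:: 1;2;4;1;5]; [:: 5;0;1;5;2]; [:: 0;1;5;0;6]];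
  [:: [:: 5;0;6;1;2]; [:: 0;6;4;5;0]; [:: 3;4;1;2;6]; [:: 4;1;5;0;1]; [:: 1;5;2;6;5]];
  [:: [:: 5;0;6;1;2]; [:: 0;6;4;5;0]; [:: 3;4;5;2;6]; [:: 4;1;2;4;5]; [:: 5;2;4;1;2]];
  [:: [:: 5;0;1;5;2]; [:: 0;1;2;0;6]; [:: 3;2;6;1;5]; [:: 2;6;4;5;2]; [:: 4;5;0;3;6]];
  [:: [:: 2;0;6;1;2]; [:: 0;3;4;5;0]; [:: 6;1;5;0;3]; [:: 1;2;0;3;4]; [:: 2;0;6;1;5]];
  [:: [:: 2;0;6;1;2]; [:: 0;6;4;5;0]; [:: 6;4;5;2;6]; [:: 5;0;3;4;5]; [:: 2;6;4;0;3]];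
  [:: [:: 5;2;4;5;2]; [:: 3;6;1;2;6]; [:: 4;5;2;6;5]; [:: 1;2;4;5;2]; [:: 2;4;5;2;4]];
  [:: [:: 0;6;5;0;6]; [:: 6;1;2;6;1]; [:: 1;5;0;1;2]; [:: 2;0;3;2;0]; [:: 0;3;2;0;3]];
  [:: [:: 3;4;5;2;0]; [:: 6;1;2;0;6]; [:: 5;2;0;3;1]; [:: 2;0;6;4;5]; [:: 0;3;1;5;0]];
  [:: [:: 2;6;5;2;0]; [:: 4;5;2;0;6]; [:: 5;2;0;6;5]; [:: 3;4;1;5;2]; [:: 4;1;5;3;6]];
  [:: [:: 0;1;5;0;6]; [:: 3;2;0;3;1]; [:: 2;0;6;1;2]; [:: 0;1;5;2;4]; [:: 6;5;2;4;5]];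
  [:: [:: 0;6;1;2;0]; [:: 3;4;5;0;6]; [:: 2;0;3;6;4]; [:: 0;3;6;4;5]; [:: 1;2;4;1;2]];
  [:: [:: 0;6;1;2;6]; [:: 6;1;2;6;1]; [:: 5;2;6;4;5]; [:: 0;6;4;0;3]; [:: 6;5;0;3;4]];
  [:: [:: 0;1;5;2;6]; [:: 3;2;0;6;1]; [:: 6;4;1;5;2]; [:: 1;5;2;0;6]; [:: 2;0;6;1;5]];
  [:: [:: 3;6;5;2;0]; [:: 6;1;2;0;3]; [:: 1;2;0;6;1]; [:: 5;0;3;4;5]; [:: 2;6;1;5;2]];
  [:: [:: 3;2;0;3;6]; [:: 6;4;1;2;4]; [:: 4;1;2;4;5]; [:: 5;2;4;5;2]; [:: 2;0;1;2;6]];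
  [:: [:: 0;1;5;0;1]; [:: 6;5;3;1;5]; [:: 5;3;6;5;3]; [:: 2;6;5;2;4]; [:: 6;5;2;4;1]];
  [:: [:: 0;6;5;0;1]; [:: 6;4;0;3;2]; [:: 1;5;3;6;4]; [:: 2;0;6;1;5]; [:: 0;3;1;5;2]];
  [:: [:: 0;6;5;0;1]; [:: 6;4;0;6;5]; [:: 5;0;6;4;0]; [:: 2;6;4;5;3]; [:: 6;4;0;3;4]];
  [:: [:: 0;1;5;0;6]; [:: 1;2;0;1;5]; [:: 5;0;6;5;3]; [:: 0;1;5;3;4]; [:: 1;5;2;6;1]];
  [:: [:: 0;3;2;0;3]; [:: 3;2;0;6;4]; [:: 2;0;6;4;0]; [:: 0;6;4;0;3]; [:: 3;4;0;3;2]];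
  [:: [:: 0;1;2;0;1]; [:: 3;2;0;6;5]; [:: 2;0;6;4;0]; [:: 0;6;1;5;3]; [:: 6;4;5;3;6]];
  [:: [:: 0;3;2;0;1]; [:: 3;6;4;1;5]; [:: 6;4;1;5;2]; [:: 1;5;2;0;6]; [:: 2;0;6;1;5]];
  [:: [:: 0;6;5;0;3]; [:: 3;4;0;3;4]; [:: 6;5;3;2;0]; [:: 5;3;2;4;1]; [:: 2;6;4;5;2]];
  [:: [:: 0;3;2;0;1]; [:: 6;4;0;6;5]; [:: 1;5;3;4;0]; [:: 5;2;6;5;3]; [:: 2;4;5;2;6]];
  [:: [:: 0;3;6;1;2]; [:: 1;2;4;5;0]; [:: 5;0;1;2;6]; [:: 3;1;5;0;1]; [:: 4;5;2;6;5]];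
  [:: [:: 3;6;4;5;2]; [:: 4;1;5;0;6]; [:: 5;2;0;6;1]; [:: 2;0;3;4;5]; [:: 0;6;4;5;0]];
  [:: [:: 2;6;4;5;2]; [:: 6;4;0;3;4]; [:: 5;0;3;4;1]; [:: 3;6;4;5;2]; [:: 6;4;0;3;4]];
  [:: [:: 0;3;6;1;2]; [:: 3;6;4;5;0]; [:: 2;4;1;2;6]; [:: 0;1;5;0;1]; [:: 6;5;2;6;5]];
  [:: [:: 0;3;6;1;2]; [:: 1;2;4;5;0]; [:: 5;0;1;2;6]; [:: 0;1;2;6;5]; [:: 3;2;4;1;2]];
  [:: [:: 0;6;1;5;2]; [:: 6;5;2;0;6]; [:: 5;0;6;1;5]; [:: 0;3;4;5;2]; [:: 1;2;0;3;4]];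
  [:: [:: 0;6;4;1;2]; [:: 3;4;5;2;0]; [:: 4;1;2;0;6]; [:: 1;2;0;6;1]; [:: 2;0;3;4;5]];
  [:: [:: 0;3;4;1;2]; [:: 3;6;5;2;6]; [:: 6;4;0;6;4]; [:: 1;5;3;1;5]; [:: 2;0;6;5;2]];
  [:: [:: 0;6;1;5;2]; [:: 3;1;5;0;6]; [:: 4;5;3;1;5]; [:: 1;2;4;5;2]; [:: 2;4;1;2;4]];
  [:: [:: 3;1;5;3;4]; [:: 4;5;2;6;5]; [:: 0;3;4;1;2]; [:: 3;4;5;2;4]; [:: 6;1;2;4;1]];
  [:: [:: 3;4;5;2;0]; [:: 6;1;2;0;6]; [:: 5;2;0;6;1]; [:: 2;0;3;1;5]; [:: 0;6;4;5;0]];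
  [:: [:: 3;6;5;0;6]; [:: 6;4;0;3;4]; [:: 1;5;3;4;0]; [:: 2;0;1;5;3]; [:: 4;1;5;3;4]];
  [:: [:: 1;2;0;3;6]; [:: 5;0;6;1;5]; [:: 0;3;1;5;2]; [:: 6;4;5;2;0]; [:: 1;5;2;6;1]];
  [:: [:: 3;6;1;2;0]; [:: 2;4;5;0;6]; [:: 0;1;2;6;1]; [:: 1;5;0;1;5]; [:: 5;2;6;5;2]];
  [:: [:: 3;2;0;3;6]; [:: 2;0;3;6;4]; [:: 0;3;1;5;0]; [:: 6;4;5;0;3]; [:: 4;5;0;3;4]];
  [:: [:: 1;2;0;3;4]; [:: 5;0;6;4;5]; [:: 0;6;4;5;2]; [:: 1;5;0;3;6]; [:: 2;0;3;6;1]];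
  [:: [:: 3;6;1;2;0]; [:: 2;4;5;0;3]; [:: 4;5;3;6;4]; [:: 1;2;6;1;5]; [:: 2;4;1;5;3]];
  [:: [:: 1;2;0;3;4]; [:: 2;0;3;6;1]; [:: 0;3;2;4;5]; [:: 6;4;0;1;2]; [:: 5;0;1;2;6]];
  [:: [:: 1;2;0;6;1]; [:: 2;0;3;4;5]; [:: 0;6;4;1;2]; [:: 3;4;5;2;4]; [:: 6;1;2;6;5]];
  [:: [:: 3;2;0;1;5]; [:: 6;4;1;5;2]; [:: 1;5;2;0;6]; [:: 2;0;6;1;5]; [:: 0;3;4;5;2]];
  [:: [:: 1;5;0;6;4]; [:: 2;0;3;1;5]; [:: 0;6;4;5;0]; [:: 3;4;1;2;6]; [:: 6;1;5;0;1]];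
  [:: [:: 3;2;0;6;1]; [:: 2;0;6;4;5]; [:: 0;3;4;0;3]; [:: 6;1;5;3;4]; [:: 1;5;3;6;5]];
  [:: [:: 1;5;3;6;1]; [:: 2;0;6;4;5]; [:: 0;1;5;0;3]; [:: 1;5;0;3;1]; [:: 5;2;6;1;5]];
  [:: [:: 1;5;0;6;1]; [:: 2;0;3;4;5]; [:: 0;3;1;5;0]; [:: 6;4;5;0;3]; [:: 4;5;0;6;1]];
  [:: [:: 3;2;0;6;4]; [:: 2;0;6;4;5]; [:: 6;1;5;0;3]; [:: 1;5;2;6;4]; [:: 5;0;6;1;5]];
  [:: [:: 3;2;0;6;1]; [:: 2;0;3;4;5]; [:: 0;3;4;0;3]; [:: 6;4;0;6;1]; [:: 5;0;1;5;2]];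
  [:: [:: 3;2;0;6;4]; [:: 2;0;3;1;5]; [:: 0;3;4;5;0]; [:: 1;2;0;3;6]; [:: 5;0;1;2;4]];
  [:: [:: 1;5;0;3;2]; [:: 2;0;6;4;0]; [:: 0;6;1;5;3]; [:: 3;1;5;2;6]; [:: 6;5;2;4;5]];
  [:: [:: 3;2;6;1;2]; [:: 6;4;5;2;6]; [:: 1;5;3;6;4]; [:: 2;0;6;5;0]; [:: 0;3;4;0;3]];
  [:: [:: 1;5;0;1;2]; [:: 2;0;3;2;4]; [:: 0;3;6;4;5]; [:: 3;4;1;5;2]; [:: 4;1;5;3;4]];
  [:: [:: 1;5;0;6;5]; [:: 5;0;6;4;0]; [:: 0;6;4;5;3]; [:: 6;4;1;2;6]; [:: 1;5;2;4;5]];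
  [:: [:: 6;5;0;1;2]; [:: 5;3;1;5;0]; [:: 0;1;2;0;1]; [:: 1;5;0;1;5]; [:: 5;2;6;5;2]];
  [:: [:: 3;2;0;3;2]; [:: 2;0;6;4;0]; [:: 0;3;4;5;3]; [:: 6;1;5;3;2]; [:: 1;2;0;6;4]];
  [:: [:: 3;2;0;6;5]; [:: 2;4;1;5;0]; [:: 0;1;5;0;3]; [:: 1;5;0;3;6]; [:: 5;0;3;6;1]];
  [:: [:: 6;5;0;1;2]; [:: 5;0;1;2;6]; [:: 0;3;2;6;4]; [:: 1;2;6;4;0]; [:: 2;6;4;5;3]];
  [:: [:: 6;5;0;1;5]; [:: 5;3;6;5;0]; [:: 0;6;4;0;3]; [:: 3;4;0;1;2]; [:: 2;0;1;5;0]]].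

Definition crossing (a b c d x y : nat) : nat :=
  if [|| x == 0, y == 0, x == 6 | y == 6] then crossing_rim a b c d x y
  else nth 0 (nth [::] (nth [::] crossings (27 * a + 9 * b + 3 * c + d)) y.-1) x.-1.

(** A field psi increases by 1 along both kinds of arcs away from the lines; the
    phase psi i j - (i + j) modulo 3 removes this drift. *)
Definition phase (psi : nat -> nat -> nat) (i j : nat) : nat :=
  (psi i j + (i + j).*2) %% 3.

(** The colour of the point (5, 5) of a window. A line matters for this point if
    the phase jumps at it and it separates two consecutive columns (or rows)
    among 0, ..., 5, because then the point lies in the strip starting at the
    line. There are ix columns between the line and the point, and ix = 5 encodes
    that there is no such line; likewise iy for rows.
    The reference point of a strip or a crossing, its column or row 0, is the
    last one before the line, hence column 4 - ix and row 4 - iy of the window;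
    this is where the offsets 9 - ix = (4 - ix) + 5 and
    8 - ix - iy = (4 - ix) + (4 - iy) come from. *)
Definition rule (psi : nat -> nat -> nat) : nat :=
  let nw := phase psi 0 0 in let ne := phase psi 5 0 in
  let sw := phase psi 0 5 in let se := phase psi 5 5 in
  let ix := find (fun i =>
    (phase psi (4 - i) 0 != ne) || (phase psi (4 - i) 5 != se)) (iota 0 5) in
  let iy := find (fun i =>
    (phase psi 0 (4 - i) != sw) || (phase psi 5 (4 - i) != se)) (iota 0 5) in
  if ix == 5 then
    if iy == 5 then diag (psi 5 5) else strip (se + ne.*2) iy.+1 (ne + 9 - iy)
  else if iy == 5 then strip (se + sw.*2) ix.+1 (sw + 9 - ix)
  else
    let p x := (x + 8 - ix - iy) %% 3 in
    crossing (p nw) (p ne) (p sw) (p se) ix.+1 iy.+1.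

Definition quadrant (x0 y0 : nat) (p : nat * nat * (nat * nat)) (i j : nat) : nat :=
  let: ((nw, ne), (sw, se)) := p in
  ((if y0 <= j then if x0 <= i then se else sw
    else if x0 <= i then ne else nw) + i + j) %% 3.

Definition all_phases : seq (nat * nat * (nat * nat)) :=
  let pairs := [seq (a, b) | a <- iota 0 3, b <- iota 0 3] in
  [seq (p, q) | p <- pairs, q <- pairs].

Definition right_shift (psi : nat -> nat -> nat) (i j : nat) := psi i.+1 j.
Definition down_shift (psi : nat -> nat -> nat) (i j : nat) := psi i j.+1.

Lemma rule_arcs_all : all (fun p => all (fun x0 => all (fun y0 =>
  let psi := quadrant x0 y0 p in
  R7_arc (rule psi) (rule (right_shift psi)) &&
  R7_arc (rule psi) (rule (down_shift psi))) (iota 0 7)) (iota 0 7)) all_phases.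
Proof. by vm_compute. Qed.

(** Continuity of the resulting colouring rests on this: finitely many values of
    the field determine a colour. *)
Lemma rule_ext (psi psi' : nat -> nat -> nat) :
  (forall i j, i <= 5 -> j <= 5 -> psi i j = psi' i j) -> rule psi = rule psi'.
Proof.
move=> eq_psi.
have eq_phase i j : i <= 5 -> j <= 5 -> phase psi i j = phase psi' i j.
  by move=> i5 j5; rewrite /phase eq_psi.
have four i : 4 - i <= 5 by lia.
rewrite /rule; cbv zeta.
rewrite (eq_phase 0 0) // (eq_phase 5 0) // (eq_phase 0 5) // (eq_phase 5 5) //.
rewrite (eq_psi 5 5) //.
rewrite (@eq_find _ (fun i => _ || (phase psi (4 - i) 5 != _))
  (fun i => (phase psi' (4 - i) 0 != phase psi' 5 0) ||
            (phase psi' (4 - i) 5 != phase psi' 5 5))); last first.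
  by move=> i; rewrite !eq_phase.
by rewrite (@eq_find _ (fun i => _ || (phase psi 5 (4 - i) != _))
  (fun i => (phase psi' 0 (4 - i) != phase psi' 0 5) ||
            (phase psi' 5 (4 - i) != phase psi' 5 5))) // => i; rewrite !eq_phase.
Qed.

(** All the cases that can occur have been evaluated in [rule_arcs_all], because
    inside a 7 x 7 window x0 and y0 range over seven values and the four phases
    matter modulo 3 only. *)
Lemma rule_arcs (psi : nat -> nat -> nat) (x0 y0 : nat) (P : bool -> bool -> nat) :
  x0 <= 6 -> y0 <= 6 ->
  (forall i j, i <= 6 -> j <= 6 ->
     psi i j = (P (x0 <= i) (y0 <= j) + i + j) %% 3) ->
  R7_arc (rule psi) (rule (right_shift psi)) /\ R7_arc (rule psi) (rule (down_shift psi)).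
Proof.
move=> x6 y6 psiE.
pose p := ((P false false %% 3, P true false %% 3),
           (P false true %% 3, P true true %% 3)).
have pE i j : i <= 6 -> j <= 6 -> psi i j = quadrant x0 y0 p i j.
  move=> i6 j6; rewrite psiE // /quadrant /=.
  by case: (x0 <= i); case: (y0 <= j); rewrite -!addnA modnDml.
have p_in : p \in all_phases.
  have mod_in n : n %% 3 \in iota 0 3 by rewrite mem_iota ltn_mod.
  by do 2!apply: (allpairs_f pair).
have /allP/(_ x0) := allP rule_arcs_all _ p_in; rewrite mem_iota => /(_ x6).
move=> /allP/(_ y0); rewrite mem_iota => /(_ y6) /andP[].
rewrite (@rule_ext _ psi) => [|i j ? ?]; last by rewrite pE //; lia.
rewrite (@rule_ext (right_shift _) (right_shift psi)) => [|i j ? ?];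
  last by rewrite /right_shift pE //; lia.
by rewrite (@rule_ext (down_shift _) (down_shift psi)) => [|i j ? ?] //;
  rewrite /down_shift pE //; lia.
Qed.

(** * Locally constant functions and greedy choices *)

Definition locally_constant (X : topologicalType) (T : Type) (f : X -> T) : Prop :=
  forall x, \forall y \near x, f y = f x.

Lemma near_all_seq (X : topologicalType) (I : eqType) (s : seq I)
    (P : I -> X -> Prop) (x : X) :
  (forall g, \forall y \near x, P g y) ->
  \forall y \near x, forall g, g \in s -> P g y.
Proof.
move=> nearP; elim: s => [|g s IHs]; first exact: nearW.
apply: filterS2 (nearP g) IHs => y Pg Ps h.
by rewrite inE => /predU1P[->|/Ps].
Qed.

Section Action.
Variables (X : topologicalType) (act : Z2 -> X -> X).
Hypothesis act_continuous : forall g, continuous (act g).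

Lemma locally_constant_act (T : Type) (f : X -> T) (g : Z2) :
  locally_constant f -> locally_constant (f \o act g).
Proof. by move=> f_lc x; apply: (act_continuous (x := x) (f_lc (act g x))). Qed.

(** Every point x receives the value F of the values already chosen at the
    points act g x, g in s, that precede x, that is, have a smaller c; t0 stands
    for no value. *)
Section Greedy.
Variables (T : Type) (t0 : T) (c : X -> nat) (s : seq Z2) (F : (Z2 -> T) -> T).
Hypothesis c_lc : locally_constant c.

Definition earlier (r : X -> T) (x : X) (g : Z2) : T :=
  if (g \in s) && (c (act g x) < c x) then r (act g x) else t0.

(** The recursion on c x, with a bound n on c x as fuel. *)
Fixpoint stage (n : nat) (x : X) : T :=
  if n is m.+1 then F (earlier (stage m) x) else t0.

Lemma stage_stable m n x : c x < m -> c x < n -> stage m x = stage n x.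
Proof.
elim: m n x => // m IHm [//|n] x cm cn /=; congr F; apply/funext => g.
by rewrite /earlier; case: ifP => // /andP[_ cg]; apply: IHm; lia.
Qed.

(** A stage reads c and the previous stage at x and at the finitely many points
    act g x only, and these data are locally constant. *)
Lemma stage_lc n : locally_constant (stage n).
Proof.
elim: n => [|n IHn] x; first exact: nearW.
have near_c : \forall y \near x, c y = c x by exact: c_lc.
have near_s : \forall y \near x, forall g, g \in s ->
    c (act g y) = c (act g x) /\ stage n (act g y) = stage n (act g x).
  apply: near_all_seq => g; near=> y; split; near: y.
    exact: (@locally_constant_act _ c g c_lc x).
  exact: (@locally_constant_act _ (stage n) g IHn x).
near=> y => /=; congr F; apply/funext => g; rewrite /earlier.
case: (boolP (g \in s)) => //= gs.
have [-> ->] : c (act g y) = c (act g x) /\ stage n (act g y) = stage n (act g x).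
  by move: g gs; near: y.
by have -> : c y = c x by near: y.
Unshelve. all: by end_near. Qed.

Lemma greedy_exists :
  exists r : X -> T, locally_constant r /\ forall x, r x = F (earlier r x).
Proof.
exists (fun x => stage (c x).+1 x); split=> x.
  have near_c : \forall y \near x, c y = c x by exact: c_lc.
  have near_r : \forall y \near x, stage (c x).+1 y = stage (c x).+1 x.
    exact: stage_lc.
  near=> y; have -> : c y = c x by near: y.
  by near: y.
rewrite [LHS]/=; congr F; apply/funext => g; rewrite /earlier.
by case: ifP => // /andP[_ cg]; apply: stage_stable.
Unshelve. all: by end_near. Qed.

End Greedy.
End Action.

(** * Markers with squares in general position *)

Local Open Scope ring_scope.

Definition in_range (D : nat) (u : int) : bool := - D%:Z <= u <= D%:Z.
Definition box (D : nat) (g : Z2) : bool := in_range D g.1 && in_range D g.2.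

Definition box_seq (D : nat) : seq Z2 :=
  let range := [seq k%:Z - D%:Z | k <- iota 0 (D + D).+1] in
  [seq (u, v) | u <- range, v <- range].

Lemma mem_box_seq D g : (g \in box_seq D) = box D g.
Proof.
have mem_range u : (u \in [seq k%:Z - D%:Z | k <- iota 0 (D + D).+1]) = in_range D u.
  apply/mapP/idP => [[k + ->]|]; rewrite ?mem_iota /in_range; first lia.
  by move=> uD; exists (absz (u + D%:Z)); rewrite ?mem_iota; lia.
rewrite /box -!mem_range; case: g => u v /=.
by apply/allpairsP/andP => [[[a b] /= [? ? [-> ->]]]|[? ?]] //; exists (u, v).
Qed.

(** Two lines at distance at least 6 cannot both separate columns of a window
    with the seven columns 0, ..., 6. *)
Definition far (u v : int) : bool := 6%:Z <= `|u - v|.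

(** The sides of two squares, of radius a around 0 and of radius b around a point
    with coordinate u. *)
Definition far_lines (a b u : int) : bool :=
  [&& far (- a) (u - b), far (- a) (u + b), far a (u - b) & far a (u + b)].

Definition generic (a b : int) (g : Z2) : bool :=
  far_lines a b g.1 && far_lines a b g.2.

(** The radii a, at most 44, that violate [far_lines a b u]: each of the four conditions
    excludes an interval of eleven values. *)
Definition bad_radii (b u : int) : seq int :=
  [seq s + t%:Z | s <- [:: u - b - 5%:Z; u + b - 5%:Z; b - u - 5%:Z; - u - b - 5%:Z],
                  t <- iota 0 11].

Lemma far_lines_bad a b u : a \notin bad_radii b u -> far_lines a b u.
Proof.
apply: contraR; rewrite /far_lines /far => nfar.
have in_bad s : s \in [:: u - b - 5%:Z; u + b - 5%:Z; b - u - 5%:Z; - u - b - 5%:Z] ->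
    0 <= a - s <= 10%:Z -> a \in bad_radii b u.
  move=> s_in as10; apply/allpairsP; exists (s, absz (a - s)); split.
  - exact: s_in.
  - by rewrite [_.2]/= mem_iota; lia.
  - by rewrite /=; lia.
case/nandP: nfar => [nf|/nandP[nf|/nandP[nf|nf]]].
- by apply: (in_bad (b - u - 5%:Z)); rewrite ?inE ?eqxx ?orbT //; lia.
- by apply: (in_bad (- u - b - 5%:Z)); rewrite ?inE ?eqxx ?orbT //; lia.
- by apply: (in_bad (u - b - 5%:Z)); rewrite ?inE ?eqxx ?orbT //; lia.
- by apply: (in_bad (u + b - 5%:Z)); rewrite ?inE ?eqxx ?orbT //; lia.
Qed.

(** Squares of radius at most 2N that both meet a window [0, 6] x [0, 6] have
    their centres at distance at most 2 (2N + 6). *)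
Definition reach (N : nat) : nat := (4 * N + 12)%N.

Section Radius.
Variables (N : nat) (N_large : (81 * 88 < N)%N).
Local Notation D := (reach N).

Definition radii : seq int := [seq (N + k.+1)%N%:Z | k <- iota 0 N].

Lemma mem_radii a : (a \in radii) = (N%:Z < a <= (N + N)%N%:Z).
Proof.
apply/mapP/idP => [[k + ->]|]; rewrite ?mem_iota; first lia.
by move=> aN; exists (absz a - N.+1)%N; rewrite ?mem_iota; lia.
Qed.

Definition good_radius (d : Z2 -> option int) (a : int) : bool :=
  all (fun g => if d g is Some b then generic a b g else true) (box_seq D).

(** The box of radius [reach N] is divided into cells of side N + 1, at most one
    marker in each. *)
Definition cell (g : Z2) : nat * nat :=
  ((absz (g.1 + D%:Z)%R %/ N.+1)%N, (absz (g.2 + D%:Z)%R %/ N.+1)%N).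

Lemma divn_close (m n k : nat) : (0 < k)%N ->
  (m %/ k = n %/ k)%N -> (m < n + k)%N.
Proof.
move=> k0 e; apply: leq_trans (ltn_ceil m k0) _.
by rewrite mulSn addnC leq_add2r e leq_trunc_div.
Qed.

Lemma cell_inj g h : box D g -> box D h -> cell g = cell h -> box N (h - g).
Proof.
move=> /andP[g1 g2] /andP[h1 h2] [e1 e2].
have close u v : in_range D u -> in_range D v ->
    (absz (u + D%:Z)%R %/ N.+1 = absz (v + D%:Z)%R %/ N.+1)%N -> in_range N (v - u).
  rewrite /in_range => uD vD e.
  have := divn_close (ltn0Sn N) e; have := divn_close (ltn0Sn N) (esym e).
  by clear e; lia.
by rewrite /box; apply/andP; split; apply: close.
Qed.

Lemma cell_bound g : box D g -> ((cell g).1 < 9)%N && ((cell g).2 < 9)%N.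
Proof.
move=> /andP[]; rewrite /in_range /reach => g1 g2.
by rewrite /cell /reach /= !ltn_divLR //; move: N_large; lia.
Qed.

(** Counting: there are at most 9 * 9 cells, hence at most 81 markers in reach,
    each excluding at most 2 * 44 radii, whereas N radii are available. Here d is
    the partial map of the radii of the markers, separated by hypothesis. *)
Lemma good_radius_exists (d : Z2 -> option int) :
  (forall g h, box D g -> box D h -> d g -> d h -> box N (h - g) -> g = h) ->
  has (good_radius d) radii.
Proof.
move=> d_sep; apply: contraT => /hasPn no_good.
pose marker (p : nat * nat) := nth 0 (box_seq D)
  (find (fun g => d g && (cell g == p)) (box_seq D)).
pose forbidden p := if d (marker p) is Some b
  then bad_radii b (marker p).1 ++ bad_radii b (marker p).2 else [::].
pose cells := [seq (i, j) | i <- iota 0 9, j <- iota 0 9].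
have cover a : a \in radii -> a \in flatten [seq forbidden p | p <- cells].
  move=> /no_good /allPn[g]; rewrite mem_box_seq => gD.
  case dg : (d g) => [b|//] ngen.
  have hasg : has (fun h => d h && (cell h == cell g)) (box_seq D).
    by apply/hasP; exists g; rewrite ?mem_box_seq ?dg ?eqxx.
  have markerE : marker (cell g) = g.
    have /andP[dm /eqP cm] := nth_find 0 hasg.
    have mD : box D (marker (cell g)).
      by rewrite -mem_box_seq mem_nth // -has_find.
    by apply: d_sep => //; rewrite ?dg //; apply: cell_inj.
  apply/flattenP; exists (forbidden (cell g)).
    apply: map_f; have /andP[c1 c2] := cell_bound gD.
    by rewrite [cell g]surjective_pairing allpairs_f // mem_iota.
  rewrite /forbidden markerE dg mem_cat; apply: contraR ngen.
  by case/norP=> *; rewrite /generic !far_lines_bad.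
have : (size radii <= size (flatten [seq forbidden p | p <- cells]))%N.
  apply: uniq_leq_size => //; rewrite map_inj_uniq ?iota_uniq // => i j; lia.
rewrite size_map size_iota leqNgt => /negP[]; apply: leq_ltn_trans N_large.
have bound (ps : seq (nat * nat)) :
    (size (flatten [seq forbidden p | p <- ps]) <= size ps * 88)%N.
  elim: ps => //= p ps IHps; rewrite size_cat mulSn leq_add //.
  by rewrite /forbidden; case: (d _) => // b; rewrite size_cat !size_allpairs.
exact: (bound cells).
Qed.

End Radius.

(** The greedy step, with d the radii of the earlier markers nearby; a point with
    value [None] is not a marker. *)
Definition choose_radius (N : nat) (d : Z2 -> option int) : option int :=
  if has (fun g => d g : bool) (box_seq N) then None
  else Some (nth 0 (radii N) (find (good_radius N d) (radii N))).

Lemma generic_sym a b g : generic a b g -> generic b a (- g).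
Proof.
case: g => u v; rewrite /generic /far_lines /far /=.
by move=> /andP[/and4P[? ? ? ?] /and4P[? ? ? ?]]; apply/andP; split; lia.
Qed.

Lemma box_le m n g : (m <= n)%N -> box m g -> box n g.
Proof. by rewrite /box /in_range; lia. Qed.

Lemma boxN n g : box n g -> box n (- g).
Proof. by case: g => u v; rewrite /box /in_range /=; lia. Qed.

Section Markers.
Variables (X : topologicalType) (act : Z2 -> X -> X).
Hypothesis act_continuous : forall g, continuous (act g).
Hypothesis act0 : forall x, act 0 x = x.
Hypothesis actD : forall g h x, act g (act h x) = act (g + h) x.
Variables (N : nat) (N_large : (81 * 88 < N)%N) (c : X -> nat).
Hypothesis c_lc : locally_constant c.
Hypothesis c_distinct : forall x g, box (reach N) g -> g != 0 -> c (act g x) != c x.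

Lemma actKN g x : act (- g) (act g x) = x.
Proof. by rewrite actD addNr act0. Qed.

(** Separation and general position concern pairs of nearby points, and of two
    distinct nearby points one is earlier: so it is enough that the later one took
    the earlier one into account. A point that is not a marker was refused because
    of a marker within distance N, whence the density. *)
Lemma markers_exist : exists r : X -> option int,
  [/\ locally_constant r,
      forall x a, r x = Some a -> N%:Z < a <= (N + N)%N%:Z,
      forall x, exists2 g, box N g & r (act g x) &
      forall x g a b, box (reach N) g -> g != 0 ->
        r x = Some a -> r (act g x) = Some b -> generic a b g].
Proof.
have [r [r_lc rE]] :=
  greedy_exists act_continuous None (box_seq (reach N)) (choose_radius N) c_lc.
have earlierE x g : box (reach N) g -> (c (act g x) < c x)%N ->
    earlier act None c (box_seq (reach N)) r x g = r (act g x).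
  by rewrite /earlier mem_box_seq => -> ->.
have c_lt x g : box (reach N) g -> g != 0 ->
    (c (act g x) < c x)%N \/ (c (act (- g) (act g x)) < c (act g x))%N.
  move=> gD g0; rewrite actKN; apply/orP.
  by have := c_distinct x gD g0; rewrite neq_ltn.
have N_reach : (N <= reach N)%N by rewrite /reach; lia.
(* The separation does not depend on how the radii are chosen, and it has to come
   first, since it is what makes good radii exist. *)
have sep x g : box N g -> g != 0 -> r x -> r (act g x) -> False.
  have sep_lt y h : box N h -> (c (act h y) < c y)%N -> r y -> r (act h y) -> False.
    move=> hN ch ry rh; suff ry0 : r y = None by rewrite ry0 in ry.
    rewrite rE /choose_radius; case: hasP => // -[].
    exists h; first by rewrite mem_box_seq.
    by rewrite earlierE // (box_le N_reach).
  move=> gN g0 rx rg; have [cg|cg] := c_lt x g (box_le N_reach gN) g0.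
    exact: sep_lt rx rg.
  by apply: (sep_lt (act g x) (- g)) => //; rewrite ?boxN // actKN.
have has_good x :
    has (good_radius N (earlier act None c (box_seq (reach N)) r x)) (radii N).
  apply: good_radius_exists => // g h gD hD; rewrite /earlier.
  case: ifP => // _; case: ifP => // _ rg rh ghN; apply/eqP/negP => /negP gh.
  apply: (sep (act g x) (h - g)) => //; first by rewrite subr_eq0 eq_sym.
  by rewrite actD subrK.
have r_some x a : r x = Some a ->
    a \in radii N /\ good_radius N (earlier act None c (box_seq (reach N)) r x) a.
  rewrite rE /choose_radius; case: ifP => // _ [<-].
  by split; [apply: mem_nth; rewrite -has_find | apply: nth_find].
exists r; split => //.
- by move=> x a /r_some[]; rewrite mem_radii.
- move=> x; case rx : (r x) => [a|].
    by exists 0; rewrite ?act0 ?rx // /box /in_range /=; lia.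
  move: rx; rewrite rE /choose_radius; case: hasP => // -[g].
  rewrite mem_box_seq => gN; rewrite /earlier; case: ifP => // _ rg _.
  by exists g.
- move=> x g a b gD g0 rx rg.
  have gen_lt y h a' b' : box (reach N) h -> (c (act h y) < c y)%N ->
      r y = Some a' -> r (act h y) = Some b' -> generic a' b' h.
    move=> hD ch ry rh; have [_ /allP/(_ h)] := r_some y a' ry.
    by rewrite mem_box_seq earlierE // rh => /(_ hD).
  have [cg|cg] := c_lt x g gD g0; first exact: gen_lt rx rg.
  rewrite -[g]opprK; apply: generic_sym.
  by apply: (gen_lt (act g x) (- g)) => //; rewrite ?boxN // actKN.
Qed.

End Markers.

(** * The phase field *)

(** Half-open, so that a side separates two consecutive columns. *)
Definition in_square (a u : int) : bool := - a < u <= a.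

Lemma in_squareE a u i : in_square a (u - i) = (u - a <= i) && ~~ (u + a <= i).
Proof. by rewrite /in_square; lia. Qed.

(** At most one element x0 of L lies in [1, 6]; any other element has all of
    0, ..., 6 on the same side. So relative to L every column i looks like x0 or
    like 0, according to its side of x0. *)
Lemma one_line (L : int -> Prop) :
  (forall l l', L l -> L l' -> far l l' \/ l = l') ->
  exists2 x0 : nat, (x0 <= 6)%N & forall l (i : nat), L l -> (i <= 6)%N ->
    (l <= i%:Z) = (l <= (if (x0 <= i)%N then x0 else 0%N)%:Z).
Proof.
move=> Lfar; have [[l0 [Ll0 l0_range]]|noline] :=
    pselect (exists l, L l /\ 1 <= l <= 6%:Z).
  exists (absz l0); first by lia.
  move=> l i Ll i6; have := Lfar l l0 Ll Ll0; rewrite /far.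
  by case: leqP => ? [?|?]; lia.
exists 0%N => // l i Ll i6; rewrite leq0n.
have : ~ (1 <= l <= 6%:Z) by move=> lr; apply: noline; exists l.
by lia.
Qed.

Section Phase.
Variables (X : topologicalType) (act : Z2 -> X -> X).
Hypothesis act_continuous : forall g, continuous (act g).
Hypothesis actD : forall g h x, act g (act h x) = act (g + h) x.
Variables (N : nat) (c : X -> nat).
Hypothesis c_lc : locally_constant c.
Hypothesis c_distinct : forall x g, box (reach N) g -> g != 0 -> c (act g x) != c x.
Variable r : X -> option int.
Hypothesis r_lc : locally_constant r.
Hypothesis r_range : forall x a, r x = Some a -> N%:Z < a <= (N + N)%N%:Z.
Hypothesis r_cover : forall x, exists2 g, box N g & r (act g x).
Hypothesis r_generic : forall x g a b, box (reach N) g -> g != 0 ->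
  r x = Some a -> r (act g x) = Some b -> generic a b g.

(** Both the point act e x and the marker act h x are given relative to x, so that
    the points of one window around x can be compared. *)
Definition covers (x : X) (e h : Z2) : bool :=
  if r (act h x) is Some a
  then in_square a (h.1 - e.1) && in_square a (h.2 - e.2) else false.

Definition wins (x : X) (e h : Z2) : Prop :=
  covers x e h /\ forall h', covers x e h' -> (c (act h x) <= c (act h' x))%N.

Definition owner (x : X) (e : Z2) : Z2 := xget 0 [set h | wins x e h]%classic.

Lemma covers_box x e h : covers x e h -> box (N + N) (h - e).
Proof.
rewrite /covers; case rh : (r _) => [a|//]; have := r_range rh.
by case: h e {rh} => [h1 h2] [e1 e2]; rewrite /in_square /box /in_range /=; lia.
Qed.

Lemma covers_shift x e h : covers (act e x) 0 h = covers x e (h + e).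
Proof.
rewrite /covers actD; case: (r _) => // a.
by case: h e => [h1 h2] [e1 e2]; rewrite /= !subr0 !addrK.
Qed.

Lemma wins_exists x e : exists h, wins x e h.
Proof.
have [g gN rg] := r_cover (act e x).
have [h0 h0_cov] : exists h, covers x e h.
  exists (g + e); rewrite -covers_shift /covers; case rga : (r _) rg => [a|//] _.
  have := r_range rga; case: g gN {rga} => [g1 g2].
  by rewrite /box /in_range /in_square /=; lia.
have ex_n : exists n, `[< exists2 h, covers x e h & c (act h x) = n >].
  by exists (c (act h0 x)); apply/asboolP; exists h0.
case: (ex_minnP ex_n) => n /asboolP[h h_cov hn] n_min.
exists h; split=> // h' h'_cov; rewrite hn; apply: n_min.
by apply/asboolP; exists h'.
Qed.

(** Two markers covering the same point are within distance 4N, where c is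
    injective. *)
Lemma wins_uniq x e h h' : wins x e h -> wins x e h' -> h = h'.
Proof.
move=> [hc h_min] [h'c h'_min]; apply/eqP/negP => /negP hh'.
have /eqP[] : c (act (h - h') (act h' x)) != c (act h' x).
  apply: c_distinct; last by rewrite subr_eq0.
  have := covers_box hc; have := covers_box h'c.
  by case: h h' e {hc h_min h'c h'_min hh'} => [h1 h2] [h1' h2'] [e1 e2];
    rewrite /box /in_range /reach /=; lia.
by rewrite actD subrK; apply/eqP; rewrite eqn_leq h_min // h'_min.
Qed.

Lemma ownerP x e : wins x e (owner x e).
Proof. by rewrite /owner; case: xgetP => // noh; have [h /noh] := wins_exists x e. Qed.

Lemma owner_shift x e : owner (act e x) 0 = owner x e - e.
Proof.
apply: (wins_uniq (ownerP _ _)); have [hc h_min] := ownerP x e.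
split=> [|h']; rewrite covers_shift ?subrK // => /h_min.
by rewrite !actD subrK.
Qed.

(** The sum of the coordinates of x relative to the centre of its square, which
    grows by 1 along both generators as long as the owner stays the same. *)
Definition phase_at (x : X) : nat :=
  let o := owner x 0 in absz (modz (- (o.1 + o.2)) 3).

Lemma phase_at_lc : locally_constant phase_at.
Proof.
move=> x.
have near_box : \forall y \near x, forall h, h \in box_seq (N + N) ->
    r (act h y) = r (act h x) /\ c (act h y) = c (act h x).
  apply: near_all_seq => h; near=> y; split; near: y.
    exact: (locally_constant_act act_continuous h r_lc x).
  exact: (locally_constant_act act_continuous h c_lc x).
near=> y.
have agree h : box (N + N) h -> r (act h y) = r (act h x) /\ c (act h y) = c (act h x).
  by rewrite -mem_box_seq; move: h; near: y.
have covE h : covers y 0 h = covers x 0 h.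
  apply/idP/idP => hc; have := covers_box hc; rewrite subr0 => /agree[rh _];
  by move: hc; rewrite /covers rh.
have winE h : wins x 0 h -> wins y 0 h.
  move=> [hc h_min]; split; rewrite ?covE // => h'; rewrite covE => h'c.
  have := covers_box hc; have := covers_box h'c; rewrite !subr0.
  by move=> /agree[_ ->] /agree[_ ->]; apply: h_min.
by rewrite /phase_at (wins_uniq (ownerP y 0) (winE _ (ownerP x 0))).
Unshelve. all: by end_near. Qed.

Hypothesis N_ge3 : (3 <= N)%N.

(** Membership in the squares near a window, as far as one coordinate pr is
    concerned, is decided by the side of a single line x0. *)
Lemma one_line_window (x : X) (pr : Z2 -> int) :
  {morph pr : g h / g - h} ->
  (forall a b g, generic a b g -> far_lines a b (pr g)) ->
  exists2 x0 : nat, (x0 <= 6)%N & forall h a (i : nat), r (act h x) = Some a ->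
    box (N + N + 6) h -> (i <= 6)%N ->
    in_square a (pr h - i%:Z) =
    in_square a (pr h - (if (x0 <= i)%N then x0 else 0%N)%:Z).
Proof.
move=> prB pr_far.
pose L (l : int) := exists h a,
  [/\ r (act h x) = Some a, box (N + N + 6) h & l = pr h - a \/ l = pr h + a].
have [|x0 x06 x0P] := @one_line L; last first.
  exists x0 => // h a i rh hbox i6.
  by rewrite !in_squareE !(x0P _ i) //; exists h, a; split; auto.
move=> l l' [h [a [rh hbox lE]]] [h' [a' [rh' hbox' lE']]].
have := r_range rh; have [hh'|hh'] := eqVneq h h'.
  move: rh'; rewrite -hh' rh => -[aa'] a_range.
  by case: lE => ->; case: lE' => ->; rewrite -hh' -aa' /far; lia.
(* The opposite sides of one square are far apart by the size of the square,
   sides of different squares by general position. *)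
have : generic a a' (h' - h).
  apply: (r_generic _ _ rh); rewrite ?actD ?subrK //; last by rewrite subr_eq0 eq_sym.
  move: hbox hbox'; case: (h) (h') => [h1 h2] [h1' h2'].
  by rewrite /box /in_range /reach /=; lia.
move=> /pr_far; rewrite prB /far_lines /far => /and4P[f1 f2 f3 f4] _; left.
by case: lE => ->; case: lE' => ->; lia.
Qed.

Lemma phase_quadrants x : exists x0 y0 (P : bool -> bool -> nat),
  [/\ (x0 <= 6)%N, (y0 <= 6)%N & forall i j : nat, (i <= 6)%N -> (j <= 6)%N ->
    phase_at (act (i%:Z, j%:Z) x) = ((P (x0 <= i) (y0 <= j) + i + j) %% 3)%N].
Proof.
have [x0 x06 x0P] := @one_line_window x fst (fun _ _ => erefl)
  (fun _ _ _ gen => proj1 (andP gen)).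
have [y0 y06 y0P] := @one_line_window x snd (fun _ _ => erefl)
  (fun _ _ _ gen => proj2 (andP gen)).
pose e (b b' : bool) : Z2 := ((if b then x0 else 0%N)%:Z, (if b' then y0 else 0%N)%:Z).
pose P b b' := let o := owner x (e b b') in absz (modz (- (o.1 + o.2)) 3).
exists x0, y0, P; split=> // i j i6 j6.
have coverE h : covers x (i%:Z, j%:Z) h = covers x (e (x0 <= i) (y0 <= j))%N h.
  rewrite /covers; case rh : (r _) => [a|//] /=.
  have [hbox|/negP hbox] := boolP (box (N + N + 6) h).
    by rewrite (x0P _ _ i rh) // (y0P _ _ j rh).
  have := r_range rh; rewrite /in_square.
  suff out (u v : int) : 0 <= u <= 6%:Z -> 0 <= v <= 6%:Z -> N%:Z < a <= (N + N)%N%:Z ->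
      (- a < h.1 - u <= a) && (- a < h.2 - v <= a) = false.
    by move=> a_range; rewrite /e /= !out //; do ?case: ifP => _; lia.
  by move: hbox; rewrite /box /in_range; lia.
(* The corners e b b' represent the four quadrants: the same squares cover (i, j)
   and the corner of its quadrant, hence they have the same owner. *)
have ownerE : owner x (i%:Z, j%:Z) = owner x (e (x0 <= i) (y0 <= j))%N.
  have [hc h_min] := ownerP x (e (x0 <= i) (y0 <= j))%N.
  apply: (wins_uniq (ownerP _ _)); split; first by rewrite coverE.
  by move=> h'; rewrite coverE; apply: h_min.
rewrite /phase_at /P owner_shift ownerE; case: (owner _ _) => o1 o2 /=.
lia.
Qed.

End Phase.

(** The combinatorial heart, for an arbitrary continuous action of Z^2 whose
    nearby orbit points can be separated by locally constant functions. *)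
Lemma continuous_R7_colouring (X : topologicalType) (act : Z2 -> X -> X) :
  (forall g, continuous (act g)) -> (forall x, act 0 x = x) ->
  (forall g h x, act g (act h x) = act (g + h) x) ->
  (forall D, exists2 c : X -> nat, locally_constant c &
    forall x g, box D g -> g != 0 -> c (act g x) != c x) ->
  exists2 f : X -> 'I_7, locally_constant f &
    forall x, R7 (f x) (f (act e1 x)) /\ R7 (f x) (f (act e2 x)).
Proof.
move=> act_cont act0 actD separating.
pose N := (81 * 88).+1; have N_large : (81 * 88 < N)%N by exact: ltnSn.
have N3 : (3 <= N)%N by apply: leq_trans N_large.
have [c c_lc c_distinct] := separating (reach N).
(* From here on only the lower bound on N counts, not its unary value. *)
move: N N_large N3 c_distinct => N N_large N3 c_distinct.
have [r [r_lc r_range r_cover r_generic]] :=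
  markers_exist act_cont act0 actD N_large c_lc c_distinct.
pose window x (i j : nat) := phase_at act c r (act (i%:Z, j%:Z) x).
have ph_lc : locally_constant (phase_at act c r).
  exact: (phase_at_lc act_cont actD c_lc c_distinct r_lc r_range r_cover).
have right_windowE x : window (act e1 x) = right_shift (window x).
  apply/funext => i; apply/funext => j; rewrite /window /right_shift actD.
  by congr (phase_at _ _ _ (act _ _)); rewrite /e1; congr pair; rewrite /=; lia.
have down_windowE x : window (act e2 x) = down_shift (window x).
  apply/funext => i; apply/funext => j; rewrite /window /down_shift actD.
  by congr (phase_at _ _ _ (act _ _)); rewrite /e2; congr pair; rewrite /=; lia.
exists (fun x => inord (rule (window x))) => x.
  have near_window : \forall y \near x, forall g : Z2, g \in box_seq 5 ->
      phase_at act c r (act g y) = phase_at act c r (act g x).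
    apply: near_all_seq => g; exact: (locally_constant_act act_cont g ph_lc x).
  apply: filterS near_window => y yx; congr inord.
  apply: rule_ext => i j i5 j5; apply: yx.
  by rewrite mem_box_seq /box /in_range /=; lia.
have [x0 [y0 [P [x06 y06 PE]]]] :=
  phase_quadrants actD c_distinct r_range r_cover r_generic N3 x.
have [arc1 arc2] := @rule_arcs (window x) x0 y0 P x06 y06 PE.
by split; apply: R7_inord; rewrite ?right_windowE ?down_windowE.
Qed.

(** * The free part of the shift *)

Lemma shift_actD g h x : shift_act g (shift_act h x) = shift_act (g + h) x.
Proof. by apply/funext => k; rewrite /shift_act addrA. Qed.

Lemma shift_act0 x : shift_act 0 x = x.
Proof. by apply/funext => k; rewrite /shift_act addr0. Qed.

Lemma free_part_shift g x : free_part x -> free_part (shift_act g x).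
Proof.
move=> x_free h h0 fixed; apply: (x_free h h0).
by rewrite -[LHS]shift_act0 -[RHS]shift_act0 -(addNr g) -!shift_actD
  [shift_act g (shift_act h x)]shift_actD [g + h]addrC -shift_actD fixed.
Qed.

Definition free_space : Type := set_type free_part.
HB.instance Definition _ := Topological.on free_space.

Definition free_act (g : Z2) (x : free_space) : free_space :=
  SigSub (mem_set (@free_part_shift g _ (set_valP x))).

Lemma free_act_val g x : set_val (free_act g x) = shift_act g (set_val x).
Proof. by []. Qed.

Lemma shift_act_continuous g : continuous (shift_act g).
Proof.
move=> x; apply/cvg_sup => h; move: x.
apply: (@continuous_comp_initial _ _ _ (fun y : shift_space => y h)).
exact: (@proj_continuous Z2 (fun=> bool) (h + g)).
Qed.

Lemma set_val_continuous : continuous (set_val : free_space -> shift_space).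
Proof. exact: initial_continuous. Qed.

Lemma free_act_continuous g : continuous (free_act g).
Proof.
apply: (@continuous_comp_initial _ _ _ (set_val : free_space -> shift_space)).
move=> x; apply: (@continuous_comp _ _ _ set_val (shift_act g)).
  exact: set_val_continuous.
exact: shift_act_continuous.
Qed.

Lemma coordinate_lc (h : Z2) : locally_constant (fun x : free_space => set_val x h).
Proof.
move=> x.
have cont : continuous
    ((@proj Z2 (fun=> bool) h) \o (set_val : free_space -> shift_space)).
  move=> y; apply: continuous_comp; first exact: set_val_continuous.
  exact: proj_continuous.
exact: (cont x _ (discrete_set1 (set_val x h : bool))).
Qed.

Definition separated_by (D n : nat) (x : shift_space) : bool :=
  all (fun g => (g == 0) || has (fun h => x (h + g) != x h) (box_seq n)) (box_seq D).

Lemma separated_by_exists D x :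
  free_part x -> exists n, separated_by D n x.
Proof.
move=> x_free.
have sep_mono m n g : (m <= n)%N -> has (fun h => x (h + g) != x h) (box_seq m) ->
    has (fun h => x (h + g) != x h) (box_seq n).
  move=> mn /hasP[h]; rewrite mem_box_seq => hm xh.
  by apply/hasP; exists h; rewrite ?mem_box_seq // (box_le mn).
rewrite /separated_by; elim: (box_seq D) => [|g s [n sn]]; first by exists 0%N.
have [g0|g0] := eqVneq g 0.
  by exists n; rewrite /= g0 eqxx.
have [h xh] : exists h, x (h + g) != x h.
  apply: contrapT => noh; apply: (x_free g); first exact/eqP.
  apply/funext => h; apply/eqP; apply: contrapT => /negP xh.
  by apply: noh; exists h.
pose m := maxn (absz h.1) (absz h.2).
exists (maxn m n); apply/andP; split.
  apply/orP; right; apply/hasP; exists h => //; rewrite mem_box_seq /box /in_range.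
  by rewrite /m; lia.
apply/allP => g' /(allP sn) /orP[->//|xg'].
by rewrite (sep_mono n) ?orbT // leq_maxr.
Qed.

(** Colour x by the least n such that [separated_by D n x] together with the
    pattern of x on the window of radius n. If x and act g x had the same colour,
    they would agree on a window on which they are known to differ. Both parts of
    the colour are determined by finitely many coordinates of x. *)
Lemma separating_colouring D : exists2 c : free_space -> nat, locally_constant c &
  forall x g, box D g -> g != 0 -> c (free_act g x) != c x.
Proof.
have sepP (x : free_space) : exists n, separated_by D n (set_val x).
  exact: separated_by_exists (set_valP x).
pose scale x := ex_minn (sepP x).
have near_eq (s : seq Z2) (x : free_space) : \forall y \near x,
    forall h, h \in s -> set_val y h = set_val x h.
  by apply: near_all_seq => h; exact: coordinate_lc.
have sep_lc n : locally_constant (fun x : free_space => separated_by D n (set_val x)).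
  move=> x; apply: filterS (near_eq ([seq h + g | h <- box_seq n, g <- box_seq D]
    ++ box_seq n) x) => y yx.
  apply: eq_in_all => g gD; congr orb; apply: eq_in_has => h hn.
  by rewrite !yx // mem_cat ?hn ?orbT // allpairs_f.
have scale_lc : locally_constant scale.
  move=> x.
  have near_sep : \forall y \near x, forall n, n \in iota 0 (scale x).+1 ->
      separated_by D n (set_val y) = separated_by D n (set_val x).
    by apply: near_all_seq => n; exact: sep_lc.
  apply: filterS near_sep => y; rewrite /scale.
  case: ex_minnP => m mx m_min; case: ex_minnP => n ny n_min yx.
  have nm : (n <= m)%N by apply: n_min; rewrite yx // mem_iota /=; lia.
  by apply/eqP; rewrite eqn_leq nm m_min // -yx // mem_iota /=; lia.
pose pattern x := [seq set_val x h | h <- box_seq (scale x)].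
exists (fun x => pickle (scale x, pattern x)).
  move=> x; have near_scale : \forall y \near x, scale y = scale x by exact: scale_lc.
  apply: filterS2 near_scale (near_eq (box_seq (scale x)) x) => y yx yh.
  by rewrite /pattern yx; congr (pickle (_, _)); apply/eq_in_map.
move=> x g gD g0; apply/negP => /eqP /(pcan_inj pickleK) code_eq.
have scaleE : scale (free_act g x) = scale x := congr1 fst code_eq.
have patternE : pattern (free_act g x) = pattern x := congr1 snd code_eq.
have : separated_by D (scale x) (set_val x) by rewrite /scale; case: ex_minnP.
move=> /allP/(_ g); rewrite mem_box_seq gD (negPf g0) => /(_ isT) /hasP[h hn].
move: patternE; rewrite /pattern scaleE => /eq_in_map /(_ h hn).
by rewrite free_act_val /shift_act => ->; rewrite eqxx.
Qed.

Theorem proposition5p1 :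
  (exists f : Gamma 1 3 4 -> 'I_7, digraph_hom (@Gamma_arc 1 3 4) R7 f) /\
  (exists k : nat, is_chi_co schreier_arc k /\ (k <= 7)%N).
Proof.
split; first exact: Gamma_hom_R7.
have seven : co_colorable schreier_arc 7.
  exists 'I_7, R7; split; [exact: (proj1 R7_tournament) | exact: card_ord |].
  have [||f f_lc f_arc] :=
    continuous_R7_colouring free_act_continuous _ _ separating_colouring.
  - by move=> x; apply: val_inj; exact: shift_act0.
  - by move=> g h x; apply: val_inj; exact: shift_actD.
  exists f; split.
    move=> x A /nbhs_singleton Afx; apply: filterS (f_lc x) => y.
    by rewrite /preimage /= => ->.
  move=> x y xy; have [right down] := f_arc x.
  by case: xy => [yx|yx]; [have -> : y = free_act e1 x | have -> : y = free_act e2 x];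
    try exact: val_inj.
have ex_k : exists k, `[< co_colorable schreier_arc k >] by exists 7%N; apply/asboolP.
case: (ex_minnP ex_k) => k /asboolP k_col k_min.
exists k; split; last by apply: k_min; apply/asboolP.
by split=> // m m_col; apply: k_min; apply/asboolP.
Qed.
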